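(* Let $n,d\geq 1$ be integers and put $t_{n,d}=\frac{d}{n+1}$. Let $S_{n,d}$ be the fundamental set of one-parameter subgroups and let $0=t_0<t_1<\cdots<t_{n,d}$ be the GIT walls (both defined in the context). All GIT walls $\{t_0,\ldots,t_{n,d}\}$ correspond to a subset of the finite set $$\left\{ -\frac{\langle m,\lambda\rangle}{\langle x_i, \lambda\rangle} \ \middle|\ m \text{ is a monomial of degree } d \text{ in } x_0,\dots,x_{n+1},\ 0\leq i\leq n+1,\ \lambda\in S_{n,d} \right\}$$ (taken over those $i,\lambda$ with $\langle x_i,\lambda\rangle\neq 0$), and they are contained in the interval $[0,t_{n,d}]$. Every pair $(X,H)$ has an interval of stability $[a,b]$ (possibly empty, namely when $(X,H)$ is not $t$-semistable for any $t$) with $a,b\in\{t_0,\ldots,t_{n,d}\}$. Namely, $(X,H)$ is $t$-semistable if and only if $t\in[t_i,t_j]$ for some walls $t_i,t_j$ (where $a=t_i$ and $b=t_j$ depend only on $(X,H)$). If $(X,H)$ is $t$-stable for some $t$, then $(X,H)$ is $t$-stable if and only if $t\in(t_i,t_j)$.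
   Context: $\mathbb K$ is an algebraically closed field and $G=\mathrm{SL}(n+2,\mathbb K)$ acts on $\mathbb P^{n+1}$ with fixed homogeneous coordinates $(x_0:\cdots:x_{n+1})$. A pair $(X,H)$ consists of a hypersurface $X\subset\mathbb P^{n+1}$ of degree $d$ (the zero scheme of a nonzero form $F=\sum_I c_I x^I$ of degree $d$, up to scalar) and a hyperplane $H=\{\sum h_i x_i=0\}$. Its associated sets of monomials are $\mathcal X=\{x^I\mid c_I\neq0\}$ and $\mathcal H=\{x_i\mid h_i\neq0\}$. The stability parameter $t$ ranges over $\mathbb Q_{\geq 0}$. A normalized one-parameter subgroup is $\lambda(s)=\mathrm{Diag}(s^{r_0},\ldots,s^{r_{n+1}})$ with $r_i\in\mathbb Z$, $r_0\geq\cdots\geq r_{n+1}$, $\sum r_i=0$, not all $r_i=0$. Put $\langle x_0^{d_0}\cdots x_{n+1}^{d_{n+1}},\lambda\rangle=\sum d_i r_i$. For $t\in\mathbb Q_{\geq0}$ put $$\mu_t(X,H,\lambda)=\min\{\langle x^I,\lambda\rangle\mid x^I\in\mathcal X\}+t\min\{r_i\mid x_i\in\mathcal H\}.$$ For an arbitrary non-trivial one-parameter subgroup $\rho$ of $G$, choose $h\in G$ with $h\rho h^{-1}$ normalized and put $\mu_t(X,H,\rho)=\mu_t(h\cdot X,h\cdot H,h\rho h^{-1})$. The pair $(X,H)$ is $t$-stable (resp. $t$-semistable) if $\mu_t(X,H,\rho)<0$ (resp. $\leq0$) for all non-trivial one-parameter subgroups $\rho$ of $G$. The fundamental set $S_{n,d}$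 consists of all $\lambda=\mathrm{Diag}(s^{r_0},\ldots,s^{r_{n+1}})$ with $(r_0,\ldots,r_{n+1})=c(\gamma_0,\ldots,\gamma_{n+1})\in\mathbb Z^{n+2}$ such that: (1) $\gamma_i=a_i/b_i\in\mathbb Q$ with $\gcd(a_i,b_i)=1$ and $c=\mathrm{lcm}(b_0,\ldots,b_{n+1})$; (2) $1=\gamma_0\geq\gamma_1\geq\cdots\geq\gamma_{n+1}=-1-\sum_{i=1}^n\gamma_i$; (3) $(\gamma_0,\ldots,\gamma_{n+1})$ is the unique solution (subject to $\gamma_0=1$ and $\sum\gamma_i=0$) of a consistent linear system of $n$ equations chosen from $\{\gamma_i-\gamma_{i+1}=0\mid i=0,\ldots,n\}\cup\{\sum_{i=0}^{n+1}(d_i-\bar d_i)\gamma_i=0\mid d_i,\bar d_i\in\mathbb Z_{\geq0},\ \sum d_i=\sum\bar d_i=d\}$. GIT walls: the values $t_0=0$ and $t_{n,d}$, together with all $t>0$ at which the set of $t$-semistable pairs changes, i.e. such that the set of $t'$-semistable pairs is not constant for rational $t'\geq 0$ in any neighbourhood of $t$.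
   Formalization: For d=1 the wall t_0=0 is exempted from lying in the finite set (0 is never in that set then); and ''t-stable iff t in (t_i,t_j)'' is not asserted at t=0 when t_i=0, since e.g. a smooth cubic X is 0-stable although 0 is not in (0,t_j). *)

(* Defs.v *)
From HB Require Import structures.
From mathcomp Require Import all_boot all_order all_algebra.
From mathcomp Require Import boolp classical_sets cardinality.
From mathcomp Require Import mpoly.

Set Implicit Arguments.
Unset Strict Implicit.
Unset Printing Implicit Defensive.

Import Order.TTheory GRing.Theory Num.Theory.
Local Open Scope ring_scope.

(* X is represented by a nonzero form of degree d and H = {sum_i h_i x_i = 0}
   by the nonzero row vector (h_i); all the notions below are invariant under
   rescaling either representative. *)
Record pair (K : closedFieldType) (n d : nat) := Pair {
  form : {mpoly K[n.+2]};
  hyp : 'rV[K]_n.+2;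
  form_homog : form \is d.-homog;
  form_neq0 : form != 0;
  hyp_neq0 : hyp != 0
}.

(* <x^m, lambda> for lambda(s) = Diag(s^(r_0), ..., s^(r_(n+1))). *)
Definition pairing (n : nat) (m : 'X_{1..n.+2}) (r : 'rV[int]_n.+2) : int :=
  \sum_(i < n.+2) (m i)%:Z * r 0 i.

(* The minimum of a nonempty sequence (0 on the empty sequence, which does not
   occur for pairs). *)
Definition seq_min (s : seq int) : int := \big[Num.min/head 0 s]_(x <- s) x.

Definition mu_diag (K : closedFieldType) (n : nat) (t : rat)
    (F : {mpoly K[n.+2]}) (h : 'rV[K]_n.+2) (r : 'rV[int]_n.+2) : rat :=
  (seq_min [seq pairing m r | m <- msupp F])%:~R
  + t * (seq_min [seq r 0 i | i <- enum 'I_n.+2 & h 0 i != 0])%:~R.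

Definition normalized (n : nat) (r : 'rV[int]_n.+2) : Prop :=
  [/\ forall i j : 'I_n.+2, (i <= j)%N -> r 0 j <= r 0 i,
      \sum_(i < n.+2) r 0 i = 0
    & r != 0].

Definition diag_subgroup (K : closedFieldType) (n : nat)
    (r : 'rV[int]_n.+2) (s : K) : 'M[K]_n.+2 :=
  diag_mx (\row_i s ^ r 0 i).

(* A morphism of algebraic groups G_m -> SL(n+2, K), as a function on K whose
   value at 0 is irrelevant: the entries are Laurent polynomials P_ij / s^N. *)
Definition one_param_subgroup (K : closedFieldType) (n : nat)
    (rho : K -> 'M[K]_n.+2) : Prop :=
  [/\ exists (N : nat) (P : 'M[{poly K}]_n.+2),
        forall s : K, s != 0 -> forall i j, rho s i j = (P i j).[s] / s ^+ N,
      forall s : K, s != 0 -> \det (rho s) = 1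
    & forall s u : K, s != 0 -> u != 0 -> rho (s * u) = rho s *m rho u].

Definition nontrivial (K : closedFieldType) (n : nat)
    (rho : K -> 'M[K]_n.+2) : Prop :=
  exists2 s : K, s != 0 & rho s <> 1%:M.

(* g acts on points (column vectors) by x |-> g x, so the image g.X of the zero
   scheme of F is the zero scheme of F o g^-1, and likewise for H. *)
Definition act_form (K : closedFieldType) (n : nat) (g : 'M[K]_n.+2)
    (F : {mpoly K[n.+2]}) : {mpoly K[n.+2]} :=
  comp_mpoly
    [tuple \sum_(j < n.+2) invmx g i j *: ('X_j : {mpoly K[n.+2]}) | i < n.+2] F.

Definition act_hyp (K : closedFieldType) (n : nat) (g : 'M[K]_n.+2)
    (h : 'rV[K]_n.+2) : 'rV[K]_n.+2 :=
  h *m invmx g.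

(* The pairs (g, r) with g in SL(n+2, K) such that g rho g^-1 is the normalized
   one-parameter subgroup with weights r. *)
Definition normalizations (K : closedFieldType) (n : nat)
    (rho : K -> 'M[K]_n.+2) : set ('M[K]_n.+2 * 'rV[int]_n.+2) :=
  [set gr | [/\ \det gr.1 = 1, normalized gr.2
    & forall s : K, s != 0 ->
        gr.1 *m rho s *m invmx gr.1 = diag_subgroup gr.2 s]]%classic.

(* [xget] is the choice of a normalization; its default value (1, 0) is returned
   only if there is none, which does not happen for a non-trivial rho since
   one-parameter subgroups are diagonalizable. *)
Definition mu (K : closedFieldType) (n d : nat) (t : rat) (P : pair K n d)
    (rho : K -> 'M[K]_n.+2) : rat :=
  let gr := xget (1%:M, 0) (normalizations rho) in
  mu_diag t (act_form gr.1 (form P)) (act_hyp gr.1 (hyp P)) gr.2.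

Definition semistable (K : closedFieldType) (n d : nat) (t : rat)
    (P : pair K n d) : Prop :=
  forall rho : K -> 'M[K]_n.+2,
    one_param_subgroup rho -> nontrivial rho -> mu t P rho <= 0.

Definition stable (K : closedFieldType) (n d : nat) (t : rat)
    (P : pair K n d) : Prop :=
  forall rho : K -> 'M[K]_n.+2,
    one_param_subgroup rho -> nontrivial rho -> mu t P rho < 0.

(* The row vector e stands for the linear equation sum_i e_i gamma_i = 0. *)
Definition fundamental_equation (n d : nat) (e : 'rV[rat]_n.+2) : Prop :=
  (exists i : 'I_n.+1,
     e = delta_mx 0 (widen_ord (leqnSn n.+1) i) - delta_mx 0 (lift ord0 i))
  \/ (exists m m' : 'X_{1..n.+2},
        [/\ mdeg m = d, mdeg m' = d
          & e = \row_i ((m i)%:R - (m' i)%:R)]).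

Definition solves (n : nat) (eqs : 'I_n -> 'rV[rat]_n.+2)
    (gamma : 'rV[rat]_n.+2) : Prop :=
  [/\ gamma 0 ord0 = 1,
      \sum_(i < n.+2) gamma 0 i = 0
    & forall k, \sum_(i < n.+2) eqs k 0 i * gamma 0 i = 0].

(* A repeated equation in eqs is harmless: n + 2 unknowns subject to fewer than
   n + 2 independent conditions have no unique solution. *)
Definition fundamental_set (n d : nat) : set 'rV[int]_n.+2 :=
  [set r : 'rV[int]_n.+2 | exists gamma : 'rV[rat]_n.+2,
    [/\ forall i : 'I_n.+2, (r 0 i)%:~R =
          (\big[lcmn/1%N]_(j < n.+2) absz (denq (gamma 0%R j)))%:R * gamma 0 i,
        [/\ gamma 0 ord0 = 1,
            forall i j : 'I_n.+2, (i <= j)%N -> gamma 0 j <= gamma 0 i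
          & gamma 0 ord_max =
            - 1 - \sum_(i < n.+2 | (1 <= i <= n)%N) gamma 0 i]
      & exists eqs : 'I_n -> 'rV[rat]_n.+2,
          [/\ forall k, fundamental_equation d (eqs k),
              solves eqs gamma
            & forall gamma', solves eqs gamma' -> gamma' = gamma]]]%classic.

Arguments fundamental_set : clear implicits.

Definition candidate_walls (n d : nat) : set rat :=
  [set q : rat | exists (m : 'X_{1..n.+2}) (i : 'I_n.+2) (r : 'rV[int]_n.+2),
    [/\ mdeg m = d, fundamental_set n d r, r 0 i != 0
      & q = - ((pairing m r)%:~R / (r 0 i)%:~R)]]%classic.

Definition t_max (R : archiRealFieldType) (n d : nat) : R := d%:R / n.+1%:R.

Definition semistable_pairs (K : closedFieldType) (n d : nat) (t : rat) :
    set (pair K n d) :=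
  [set P | semistable t P]%classic.

Arguments semistable_pairs : clear implicits.

(* Stability parameters are rational. Walls are located in an arbitrary
   archimedean ordered field R, which may be the rationals or the reals, so that
   irrational walls are not excluded by definition. *)
Definition git_walls (K : closedFieldType) (R : archiRealFieldType)
    (n d : nat) : set R :=
  [set t : R | t = 0 \/ t = t_max R n d \/
    (0 < t /\
     forall eps : R, 0 < eps ->
       ~ (forall q q' : rat, 0 <= q -> 0 <= q' ->
            `|ratr q - t| < eps -> `|ratr q' - t| < eps ->
            semistable_pairs K n d q = semistable_pairs K n d q'))]%classic.

Arguments git_walls : clear implicits.

(* Main.v *)
Require Import Defs.
From mathcomp Require Import all_boot all_order all_algebra.
From mathcomp Require Import boolp classical_sets cardinality.
From mathcomp Require Import mpoly.
From mathcomp Require Import ring lra zify.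

(** The set of parameters at which a pair is semistable is cut out by
    inequalities [A + t * B <= 0], one for each one-parameter subgroup, where [A]
    is the minimal weight of a monomial of the form and [B] the minimal weight of
    a coordinate of the hyperplane. Everything follows once these infinitely many
    inequalities are replaced by finitely many whose zeros are candidate walls.

    The numbers [A] and [B] do not depend on the normalization chosen for a
    subgroup, because two normalizations differ by a matrix that only mixes
    coordinates of equal weight ([normalizations_mu]). Hence semistability may be
    tested on all [g] in SL(n+2) and all normalized weights [r]. For fixed [g],
    the value is a linear function of [r] on each closed cell of the arrangement
    of hyperplanes given by the steps [gamma_i - gamma_(i+1)] and the differences
    of monomials of degree [d]: there the same monomial and the same coordinate
    realize the minima. Normalized by [gamma_0 = 1], a closed cell is a polytope
    whose vertices are, up to scaling, elements of the fundamental set, so a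
    positive value at [r] forces a positive value at a vertex ([vertex_of_cell],
    [fundamental_destabilizes]). The fundamental set is finite, hence so is the
    set of pairs [(A, B)] that occur for it ([semistable_inequalities]).

    For [t > d / (n+1)] no pair is semistable: put the hyperplane in the position
    [x_0 = 0] and use the weights [(n+1, -1, ..., -1)] ([unstable_above]). A finite
    system of inequalities that is bounded in this way has an interval [[a, b]] of
    solutions, and some inequality is tight at each end other than zero
    ([half_lines_interval]). Semistability of the pair changes at these ends,
    which are therefore walls; conversely nothing changes away from the zeros of
    the finitely many possible inequalities ([positive_wall_candidate]).

    Stability fails where an inequality is tight. In the interior of the interval
    each [mu] is affine in [t] and nonpositive at both ends; if it is negative
    at some point of the interval, it is negative inside, so that stability at one
    parameter propagates. *)

Set Implicit Arguments.
Unset Strict Implicit.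
Unset Printing Implicit Defensive.

Import Order.TTheory GRing.Theory Num.Theory.
Local Open Scope ring_scope.

(** * Linear forms and sign patterns *)

Definition eval_form (N : nat) (e g : 'rV[rat]_N) : rat := \sum_i e 0 i * g 0 i.

Lemma eval_formD N (e g h : 'rV[rat]_N) :
  eval_form e (g + h) = eval_form e g + eval_form e h.
Proof.
by rewrite /eval_form -big_split; apply: eq_bigr => i _; rewrite mxE mulrDr.
Qed.

Lemma eval_formZ N (e g : 'rV[rat]_N) c :
  eval_form e (c *: g) = c * eval_form e g.
Proof.
by rewrite /eval_form mulr_sumr; apply: eq_bigr => i _; rewrite mxE mulrCA.
Qed.

Lemma eval_formDl N (e e' g : 'rV[rat]_N) :
  eval_form (e + e') g = eval_form e g + eval_form e' g.
Proof.
by rewrite /eval_form -big_split; apply: eq_bigr => i _; rewrite mxE mulrDl.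
Qed.

Lemma eval_formZl N (e g : 'rV[rat]_N) c :
  eval_form (c *: e) g = c * eval_form e g.
Proof.
by rewrite /eval_form mulr_sumr; apply: eq_bigr => i _; rewrite mxE mulrA.
Qed.

Lemma eval_delta (N : nat) (i : 'I_N) (g : 'rV[rat]_N) :
  eval_form (delta_mx 0 i) g = g 0 i.
Proof.
rewrite /eval_form (bigD1 i) //= mxE !eqxx mul1r big1 ?addr0 // => j /negPf ji.
by rewrite mxE ji andbF mul0r.
Qed.

Lemma seq_argmin (T : eqType) (F : realDomainType) (f : T -> F) (s : seq T) :
  s != [::] -> exists2 x, x \in s & {in s, forall y, f x <= f y}.
Proof.
elim: s => // x [|y s] IHs _.
  by exists x; rewrite ?mem_head // => y; rewrite inE => /eqP->.
have [//|z zs zmin] := IHs.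
have [fxz|fzx] := leP (f x) (f z).
  exists x; rewrite ?mem_head // => w; rewrite inE => /orP[/eqP-> //|/zmin].
  exact: le_trans.
exists z; first by rewrite inE zs orbT.
by move=> w; rewrite inE => /orP[/eqP->|/zmin //]; exact: ltW.
Qed.

Lemma ltn_sub_count (T : eqType) (a b : pred T) (s : seq T) (x : T) :
  {in s, forall y, a y -> b y} -> x \in s -> b x -> ~~ a x ->
  (count a s < count b s)%N.
Proof.
move=> sab xs bx nax.
suff: (count a s + (x \in s) <= count b s)%N by rewrite xs addn1.
elim: s sab {xs} => //= y s IHs sab.
have {IHs} := IHs (fun z zs => sab z (mem_behead (s := y :: s) zs)).
have := sab y (mem_head _ _); rewrite inE.
have [<-|_] := eqVneq x y; first by rewrite bx (negPf nax); lia.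
by case: (a y) => [->|] //; lia.
Qed.

Definition exponents (N : nat) (m : 'X_{1..N}) : 'rV[rat]_N := \row_i (m i)%:R.

(** When every form of an arrangement keeps its sign in this sense from one
    point to another, the second point lies in the closure of the cell of the
    first; in particular a form that vanishes at the first point vanishes at
    the second. *)
Definition keeps_sign (F : realFieldType) (x y : F) : Prop :=
  (0 <= x -> 0 <= y) /\ (x <= 0 -> y <= 0).

Lemma keeps_sign_trans (F : realFieldType) (x y z : F) :
  keeps_sign x y -> keeps_sign y z -> keeps_sign x z.
Proof. by move=> [a b] [c e]; split=> ?; [apply/c/a | apply/e/b]. Qed.

Lemma keeps_sign0 (F : realFieldType) (x y : F) :
  keeps_sign x y -> x = 0 -> y = 0.
Proof. by move=> [a b] x0; apply/le_anti; rewrite a ?b ?x0. Qed.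

(** A pair [(x, y)] stands for the affine function [x + tau * y] of the time
    [tau], for instance a linear form along a ray. Only functions with
    [x * y < 0] can change sign, at time [- x / y]; at the smallest of these
    times no sign has been reversed yet and one function vanishes. *)
Lemma first_crossing (F : realFieldType) (s : seq (F * F)) :
  {in s, forall p, p.1 = 0 -> p.2 = 0} -> has (fun p => p.1 * p.2 < 0) s ->
  exists2 tau : F, 0 < tau &
    {in s, forall p, keeps_sign p.1 (p.1 + tau * p.2)} /\
    exists2 p, p \in s & p.1 != 0 /\ p.1 + tau * p.2 = 0.
Proof.
move=> s0; rewrite has_filter => /seq_argmin-/(_ _ (fun p => - p.1 / p.2)).
move=> [[x y]]; rewrite mem_filter /= => /andP[xy xys] tmin.
have y0 : y != 0 by apply: contraTneq xy => ->; rewrite mulr0 ltxx.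
have x0 : x != 0 by apply: contraTneq xy => ->; rewrite mul0r ltxx.
have tE : - x / y = - (x * y) / y ^+ 2 by field.
have tau_gt0 : 0 < - x / y.
  by rewrite tE divr_gt0 ?oppr_gt0 // exprn_even_gt0.
exists (- x / y) => //; split; last first.
  by exists (x, y) => //=; split=> //; field.
move=> [u v] uvs; move: (s0 _ uvs) (tmin (u, v)); rewrite mem_filter uvs andbT /=.
set tau := - x / y in tau_gt0 * => u0 tle.
have [uv|] := ltP (u * v) 0; last first.
  move=> uv; split=> /= hu.
    have [uE|un0] := eqVneq u 0; first by rewrite uE (u0 uE) mulr0 addr0.
    have u_gt0 : 0 < u by rewrite lt_neqAle eq_sym un0.
    have : 0 <= v by rewrite -(pmulr_rge0 _ u_gt0).
    by nra.
  have [uE|un0] := eqVneq u 0; first by rewrite uE (u0 uE) mulr0 addr0.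
  have u_lt0 : u < 0 by rewrite lt_neqAle un0.
  have : v <= 0 by rewrite -(nmulr_rge0 _ u_lt0).
  by nra.
have v0 : v != 0 by apply: contraTneq uv => ->; rewrite mulr0 ltxx.
have {tle} := tle uv; move: tau tau_gt0 => tau tau_gt0 tle.
have [vneg|vpos|/eqP] := ltgtP v 0; last by rewrite (negPf v0).
  have ug : 0 < u by nra.
  have : u + tau * v >= 0 by move: tle; rewrite ler_ndivlMr //; lra.
  by split; lra.
have ug : u < 0 by nra.
have : u + tau * v <= 0 by move: tle; rewrite ler_pdivlMr //; lra.
by split; lra.
Qed.

(** * Vertices of the cells of the fundamental arrangement *)

Section FundamentalVertices.

Variables (n d : nat).
Implicit Types gamma v : 'rV[rat]_n.+2.

Definition inner (j : 'I_n) : 'I_n.+2 := lift ord0 (widen_ord (leqnSn n) j).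

Lemma sum_ends (V : nmodType) (F : 'I_n.+2 -> V) :
  \sum_i F i = F ord0 + (\sum_(j < n) F (inner j) + F ord_max).
Proof.
rewrite big_ord_recl big_ord_recr /=.
by congr (_ + (_ + F _)); apply/val_inj.
Qed.

Lemma inner_ind (P : 'I_n.+2 -> Prop) :
  P ord0 -> (forall j, P (inner j)) -> P ord_max -> forall i, P i.
Proof.
move=> P0 Pi Pm i; case: (unliftP ord0 i) => [j ->|-> //].
have [jn|] := ltnP j n.
  by have := Pi (Ordinal jn); congr P; apply/val_inj.
move=> nj; have := Pm; congr P; apply/val_inj => /=.
have := ltn_ord j; rewrite ltnS => jn.
by congr _.+1; apply/eqP; rewrite eqn_leq nj.
Qed.

(** A vector [v] with [v_0 = 0] and zero sum is determined by its [n] inner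
    coordinates, so the forms in [Z] act on such vectors as a matrix with [n]
    columns. If it has full column rank, some [n] of its rows form an invertible
    matrix; otherwise its cokernel provides a nonzero [v]. *)
Lemma spanning_or_kernel (Z : seq 'rV[rat]_n.+2) :
  (exists2 eqs : 'I_n -> 'rV[rat]_n.+2, forall k, eqs k \in Z &
     forall v, v 0 ord0 = 0 -> \sum_i v 0 i = 0 ->
       (forall k, eval_form (eqs k) v = 0) -> v = 0) \/
  exists v, [/\ v != 0, v 0 ord0 = 0, \sum_i v 0 i = 0 &
     {in Z, forall e, eval_form e v = 0}].
Proof.
(* The last coordinate of [v] is minus the sum of the inner ones. *)
pose A := \matrix_(k < size Z, j < n) (Z`_k 0 (inner j) - Z`_k 0 ord_max).
have evalE (k : 'I_(size Z)) v : v 0 ord0 = 0 -> \sum_i v 0 i = 0 ->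
    eval_form Z`_k v = (A *m \col_j v 0 (inner j)) k 0.
  move=> v0; rewrite /eval_form !sum_ends v0 add0r mulr0 add0r => /eqP.
  rewrite addrC addr_eq0 => /eqP ->.
  rewrite mxE mulrN mulr_sumr -sumrB; apply: eq_bigr => j _.
  by rewrite !mxE mulrBl.
case: (boolP (row_full A)) => [fA|].
  left; exists (fun k => Z`_(fullrankfun fA k)); first by move=> k; exact: mem_nth.
  move=> v v0 vs kv; pose u := \col_j v 0 (inner j).
  have u0 : u = 0.
    rewrite -(mulKmx (fullrowsub_unit fA) u).
    suff -> : rowsub (fullrankfun fA) A *m u = 0 by rewrite mulmx0.
    apply/colP => k; rewrite [RHS]mxE -(kv k) evalE // [RHS]mxE.
    by rewrite mxE; apply: eq_bigr => j _; rewrite !mxE.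
  have vi j : v 0 (inner j) = 0 by have /colP/(_ j) := u0; rewrite !mxE.
  apply/rowP => i; rewrite [RHS]mxE; elim/inner_ind: i => //.
  by move: vs; rewrite sum_ends v0 big1 // !add0r.
rewrite -cokermx_eq0 => /matrix0Pn[i [j cij]]; right.
pose u := col j (cokermx A).
(* The default values [i] and [0] are never reached: past the two tests [k] is
   inner. *)
pose v := \row_k (if k == ord0 then 0 else if k == ord_max then - \sum_l u l 0
   else (if unlift ord0 k is Some k' then u (insubd i (val k')) 0 else 0)) : 'rV[rat]_n.+2.
have v_in l : v 0 (inner l) = u l 0.
  rewrite mxE; case: eqP => [/(congr1 val) //|_].
  rewrite /inner liftK /=; case: eqP => [/(congr1 val) /=|_].
    by rewrite /bump /=; have /= := ltn_ord l; lia.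
  by congr (u _ 0); apply/val_inj; rewrite val_insubd ltn_ord.
have v0 : v 0 ord0 = 0 by rewrite mxE eqxx.
have vs : \sum_i v 0 i = 0.
  rewrite sum_ends v0 (eq_bigr _ (fun l _ => v_in l)) add0r.
  by rewrite [v 0 ord_max]mxE /= eqxx subrr.
exists v; split=> //.
  apply: contraNneq cij => v00; have := v_in i; rewrite v00 mxE => /esym.
  by rewrite mxE => ->.
move=> e /(nthP 0)[k kZ <-]; rewrite (evalE (Ordinal kZ)) //.
have -> : \col_j v 0 (inner j) = u by apply/colP => l; rewrite mxE v_in.
by rewrite /u colE mulmxA mulmx_coker mul0mx mxE.
Qed.

(** Each entry is at most the first one, so all are nonpositive; as they add
    up to zero, they vanish. *)
Lemma sorted_sum0_eq0 (F : realDomainType) (x : 'rV[F]_n.+2) :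
  (forall i j : 'I_n.+2, (i <= j)%N -> x 0 j <= x 0 i) ->
  x 0 ord0 <= 0 -> \sum_i x 0 i = 0 -> x = 0.
Proof.
move=> xle x0 xs.
have nx0 : forall i, true -> 0 <= - x 0 i.
  by move=> i _; rewrite oppr_ge0 (le_trans _ x0) ?xle.
have /(psumr_eq0P nx0) x_eq0 : \sum_i - x 0 i = 0 by rewrite sumrN xs oppr0.
by apply/rowP => i; apply/eqP; rewrite mxE -oppr_eq0 x_eq0.
Qed.

Definition chamber gamma : Prop :=
  [/\ gamma 0 ord0 = 1, \sum_i gamma 0 i = 0
    & forall i j : 'I_n.+2, (i <= j)%N -> gamma 0 j <= gamma 0 i].

(** The forms whose nonnegativity says that the coordinates are sorted; they
    make the Weyl chamber a union of cells of the arrangement. *)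
Definition step_form (i : 'I_n.+1) : 'rV[rat]_n.+2 :=
  delta_mx 0 (widen_ord (leqnSn n.+1) i) - delta_mx 0 (lift ord0 i).

Lemma eval_step i gamma : eval_form (step_form i) gamma =
  gamma 0 (widen_ord (leqnSn n.+1) i) - gamma 0 (lift ord0 i).
Proof.
rewrite /eval_form (eq_bigr (fun j => (j == widen_ord (leqnSn n.+1) i)%:R * gamma 0 j
   - (j == lift ord0 i)%:R * gamma 0 j)); last first.
  by move=> j _; rewrite !mxE !eqxx /= mulrBl.
rewrite sumrB (bigD1 (widen_ord (leqnSn n.+1) i)) //= eqxx mul1r big1 ?addr0; last first.
  by move=> j /negPf ->; rewrite mul0r.
rewrite (bigD1 (lift ord0 i)) //= eqxx mul1r big1 ?addr0 //.
by move=> j /negPf ->; rewrite mul0r.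
Qed.

Lemma step_fundamental i : fundamental_equation d (step_form i).
Proof. by left; exists i. Qed.

Lemma sorted_steps (F : realDomainType) (x : 'rV[F]_n.+2) :
  (forall i : 'I_n.+1, x 0 (lift ord0 i) <= x 0 (widen_ord (leqnSn n.+1) i)) ->
  forall i j : 'I_n.+2, (i <= j)%N -> x 0 j <= x 0 i.
Proof.
move=> xs i j; move: {2}(j - i)%N (erefl (j - i)%N) => k; elim: k i j => [|k IHk] i j.
  move=> ij0 ij; have -> // : i = j by apply/val_inj => /=; lia.
move=> jik ij; have jn := ltn_ord j.
have j1 : (j.-1 < n.+1)%N by lia.
have := xs (Ordinal j1); have -> : lift ord0 (Ordinal j1) = j.
  by apply/val_inj; rewrite /= /bump /=; lia.
by move/le_trans; apply; apply: IHk => /=; lia.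
Qed.

Lemma monomials_finite : finite_set [set m : 'X_{1..n.+2} | mdeg m = d]%classic.
Proof.
have fin := finite_image (@bmnm n.+2 d.+1) (@finite_finset _ setT).
apply: sub_finite_set fin => m /= dm.
have md : (mdeg m < d.+1)%N by rewrite dm.
by exists (BMultinom md).
Qed.

Lemma fundamental_equations_finite :
  exists Phi : seq 'rV[rat]_n.+2, forall e, e \in Phi <-> fundamental_equation d e.
Proof.
suff /finite_seqP[s sE] :
    finite_set [set e : 'rV[rat]_n.+2 | fundamental_equation d e]%classic.
  exists s => e; have : [set` s]%classic e = (e \in s) by [].
  by rewrite -sE => <-.
have fin_steps := finite_image step_form (@finite_finset _ setT).
have fin_diff := finite_image2
  (fun m m' : 'X_{1..n.+2} => \row_i ((m i)%:R - (m' i)%:R) : 'rV[rat]_n.+2)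
  monomials_finite monomials_finite.
have := conj fin_steps fin_diff; rewrite -finite_setU; apply: sub_finite_set.
move=> e [[i ->]|[m [m' [dm dm' ->]]]]; first by left; exists i.
by right; exists m => //; exists m'.
Qed.

Lemma monomial_difference (m m' : 'X_{1..n.+2}) : mdeg m = d -> mdeg m' = d ->
  exists2 e, fundamental_equation d e & forall gamma,
    eval_form e gamma = eval_form (exponents m) gamma - eval_form (exponents m') gamma.
Proof.
move=> dm dm'; exists (\row_k ((m k)%:R - (m' k)%:R)); first by right; exists m, m'.
move=> gamma; rewrite /eval_form -sumrB.
by apply: eq_bigr => k _; rewrite !mxE mulrBl.
Qed.

(** The rational solutions from which the elements of the fundamental set are
    obtained by clearing denominators. *)
Definition vertex gamma : Prop := chamber gamma /\
  exists eqs : 'I_n -> 'rV[rat]_n.+2,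
    [/\ forall k, fundamental_equation d (eqs k), solves eqs gamma
      & forall gamma', solves eqs gamma' -> gamma' = gamma].

(** Some fundamental form must reach zero along the ray from [gamma] in the
    direction [v]: otherwise [v] itself would be sorted, and a sorted vector with
    [v_0 = 0] and zero sum vanishes. Stopping when the first form does so keeps
    the point in the closed cell of [gamma]. *)
Lemma move_in_cell gamma v (ell : 'rV[rat]_n.+2) : chamber gamma ->
  v != 0 -> v 0 ord0 = 0 -> \sum_i v 0 i = 0 ->
  (forall e, fundamental_equation d e -> eval_form e gamma = 0 -> eval_form e v = 0) ->
  0 <= eval_form ell v ->
  exists gamma', [/\ chamber gamma', eval_form ell gamma <= eval_form ell gamma',
    forall e, fundamental_equation d e ->
      keeps_sign (eval_form e gamma) (eval_form e gamma')
  & exists2 e, fundamental_equation d e &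
      eval_form e gamma != 0 /\ eval_form e gamma' = 0].
Proof.
move=> [g0 gs gle] vn0 v0 vs vker ellv.
have [Phi PhiP] := fundamental_equations_finite.
pose f e := (eval_form e gamma, eval_form e v).
have [||tau tau_gt0 [keep [_ /mapP[e /PhiP ePhi ->] /= [e0 ev]]]] :=
    @first_crossing _ (map f Phi).
- by move=> _ /mapP[e /PhiP ePhi ->] /=; exact: vker.
- apply: contraNT vn0; rewrite -all_predC => /allP opp.
  have vle : forall i j : 'I_n.+2, (i <= j)%N -> v 0 j <= v 0 i.
    apply: sorted_steps => i; rewrite -subr_ge0 -eval_step.
    have iPhi : step_form i \in Phi by apply/PhiP; exact: step_fundamental.
    have := opp _ (map_f f iPhi); rewrite /= -leNgt /f /=.
    have : 0 <= eval_form (step_form i) gamma.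
      by rewrite eval_step subr_ge0 gle //= /bump; lia.
    rewrite le_eqVlt => /orP[/eqP/esym z|pos]; last by rewrite pmulr_rge0.
    by rewrite (vker _ (step_fundamental _) z).
  by apply/eqP/(sorted_sum0_eq0 vle) => //; rewrite v0.
exists (gamma + tau *: v).
have evE e' : eval_form e' (gamma + tau *: v) = eval_form e' gamma + tau * eval_form e' v.
  by rewrite eval_formD eval_formZ.
have keep' e' : fundamental_equation d e' ->
    keeps_sign (eval_form e' gamma) (eval_form e' (gamma + tau *: v)).
  by move=> /PhiP e'Phi; rewrite evE; exact: (keep _ (map_f f e'Phi)).
split=> //; last 2 first.
- by rewrite evE lerDl mulr_ge0 // ltW.
- by exists e => //; rewrite evE.
split; first by rewrite !mxE v0 mulr0 addr0.
- rewrite -(eq_bigr _ (fun i _ => esym (mxE _ _ _ _))).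
  rewrite (eq_bigr (fun i => gamma 0 i + tau * v 0 i)) => [|i _]; last by rewrite !mxE.
  by rewrite big_split /= -mulr_sumr gs vs mulr0 addr0.
- apply: sorted_steps => i; rewrite -subr_ge0 -eval_step.
  apply: (keep' _ (step_fundamental i)).1.
  by rewrite eval_step subr_ge0 gle //= /bump; lia.
Qed.

(** A linear function on a closed cell, which is a polytope thanks to the
    normalization [gamma_0 = 1], is bounded by its value at some vertex. If the
    forms that vanish at [gamma] do not determine it, there is a direction in
    which all of them stay zero; following it, with the orientation that does not
    decrease [ell], makes one more form vanish, so the process stops. *)
Lemma vertex_of_cell (ell : 'rV[rat]_n.+2) gamma : chamber gamma ->
  exists gamma', [/\ vertex gamma', eval_form ell gamma <= eval_form ell gamma'
    & forall e, fundamental_equation d e ->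
      keeps_sign (eval_form e gamma) (eval_form e gamma')].
Proof.
have [Phi PhiP] := fundamental_equations_finite.
move: {2}(count _ _).+1 (ltnSn (count (fun e => eval_form e gamma != 0) Phi)) => k.
elim: k gamma => // k IHk gamma cnt cg; have [g0 gs gle] := cg.
have [[eqs eqsZ eqsfree]|[v [vn0 v0 vs vker]]] :=
  spanning_or_kernel [seq e <- Phi | eval_form e gamma == 0].
  exists gamma; split=> //; split=> //; exists eqs; split=> [l||gamma' [g'0 g's g'ker]].
  - by have := eqsZ l; rewrite mem_filter => /andP[_ /PhiP].
  - by split=> // l; have := eqsZ l; rewrite mem_filter => /andP[/eqP].
  apply/eqP; rewrite -subr_eq0 -scaleN1r; apply/eqP/eqsfree => [||l].
  - by rewrite !mxE g'0 g0 mulN1r subrr.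
  - under eq_bigr do rewrite !mxE mulN1r.
    by rewrite sumrB gs g's subr0.
  - rewrite eval_formD eval_formZ [eval_form _ gamma'](g'ker l) add0r.
    by have := eqsZ l; rewrite mem_filter => /andP[/eqP-> _]; rewrite mulr0.
(* The opposite direction has the same properties, so [ell] may be assumed not
   to decrease along [v]. *)
wlog ellv : v vn0 v0 vs vker / 0 <= eval_form ell v.
  move=> wl; have [/wl|] := leP 0 (eval_form ell v); first exact.
  move=> neg; apply: (wl (- 1 *: v)).
  - by rewrite scaler_eq0 negb_or vn0 oppr_eq0 oner_eq0.
  - by rewrite mxE v0 mulr0.
  - by under eq_bigr do rewrite mxE; rewrite -mulr_sumr vs mulr0.
  - by move=> e /vker ev; rewrite eval_formZ ev mulr0.
  - by rewrite eval_formZ mulN1r oppr_ge0 ltW.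
have vker' e : fundamental_equation d e -> eval_form e gamma = 0 -> eval_form e v = 0.
  by move=> /PhiP ePhi e0; apply: vker; rewrite mem_filter e0 eqxx.
have [gamma1 [cg1 le1 keep1 [e efund [en0 e0]]]] :=
  move_in_cell cg vn0 v0 vs vker' ellv.
have [|//|gamma2 [vx2 le2 keep2]] := IHk gamma1.
  rewrite -ltnS; apply: leq_trans cnt; rewrite ltnS.
  apply: (@ltn_sub_count _ _ _ _ e); rewrite ?en0 ?e0 ?eqxx //; last exact/PhiP.
  move=> e' /PhiP e'f; apply: contra => /eqP g0'.
  by rewrite (keeps_sign0 (keep1 _ e'f) g0').
exists gamma2; split=> // [|e' e'f]; first exact: le_trans le1 le2.
by apply: keeps_sign_trans (keep1 _ e'f) (keep2 _ e'f).
Qed.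

End FundamentalVertices.

(** * The numerical function of a diagonal subgroup *)

Lemma bigmin_mem_le (x0 : int) (s : seq int) :
  (\big[Num.min/x0]_(x <- s) x \in x0 :: s) /\
  {in x0 :: s, forall y, \big[Num.min/x0]_(x <- s) x <= y}.
Proof.
elim: s => [|x s [IHm IHle]].
  by rewrite big_nil mem_head; split=> // y; rewrite inE => /eqP->.
rewrite big_cons; split.
  case: leP => _; first by rewrite !inE eqxx orbT.
  by move: IHm; rewrite !inE => /orP[->|->]; rewrite ?orbT.
move=> y; rewrite !inE ge_min => /or3P[/eqP->|/eqP->|ys]; rewrite ?lexx //.
  by rewrite IHle ?mem_head ?orbT.
by rewrite IHle ?orbT // inE ys orbT.
Qed.

Lemma seq_minE (s : seq int) x : x \in s -> {in s, forall y, x <= y} -> seq_min s = x.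
Proof.
move=> xs xle; have [] := bigmin_mem_le (head 0 s) s.
rewrite -/(seq_min s) => mem le_min; apply/le_anti.
rewrite le_min ?inE ?xs ?orbT //= xle //.
by case: s xs mem {xle le_min} => //= a s _; rewrite !inE orbA orbb.
Qed.

Definition intr_row (N : nat) (r : 'rV[int]_N) : 'rV[rat]_N := map_mx intr r.

Section DiagonalMu.

Variables (K : closedFieldType) (n d : nat).
Implicit Types (F : {mpoly K[n.+2]}) (h : 'rV[K]_n.+2) (r : 'rV[int]_n.+2).

Lemma pairingE (m : 'X_{1..n.+2}) r :
  (pairing m r)%:~R = eval_form (exponents m) (intr_row r).
Proof.
rewrite /pairing rmorph_sum; apply: eq_bigr => i _.
by rewrite rmorphM !mxE.
Qed.

Lemma last_coordinate h : h != 0 ->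
  exists2 i, h 0 i != 0 & forall j, h 0 j != 0 -> (j <= i)%N.
Proof.
move=> /matrix0Pn[k [i hi]]; move: hi; rewrite ord1 => hi.
by case: (@arg_maxnP _ i (fun i => h 0 i != 0) (@nat_of_ord _) hi) => j; exists j.
Qed.

Lemma mu_diagE t F h r m i :
  m \in msupp F -> {in msupp F, forall m', pairing m r <= pairing m' r} ->
  h 0 i != 0 -> (forall j, h 0 j != 0 -> r 0 i <= r 0 j) ->
  mu_diag t F h r = (pairing m r)%:~R + t * (r 0 i)%:~R.
Proof.
move=> mF mmin hi imin; rewrite /mu_diag (@seq_minE _ (pairing m r)); last 2 first.
- exact: map_f.
- by move=> _ /mapP[m' m'F ->]; exact: mmin.
rewrite (@seq_minE _ (r 0 i)) //.
  by rewrite (map_f (fun i => r 0 i)) // mem_filter hi mem_enum.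
by move=> y /mapP[j]; rewrite mem_filter => /andP[hj _] ->; exact: imin.
Qed.

(** The index [i] is the last one in the support of [h], so it does not depend
    on [r]: for every sorted [r] the minimum over the support of [h] is [r_i]. *)
Lemma mu_diag_attained F h r : F != 0 -> h != 0 ->
  (forall i j : 'I_n.+2, (i <= j)%N -> r 0 j <= r 0 i) ->
  exists m i, [/\ m \in msupp F, {in msupp F, forall m', pairing m r <= pairing m' r},
    h 0 i != 0, forall j, h 0 j != 0 -> (j <= i)%N
    & forall t, mu_diag t F h r = (pairing m r)%:~R + t * (r 0 i)%:~R].
Proof.
rewrite -msupp_eq0 => F0 /last_coordinate[i hi imax] rle.
have [m mF mmin] := seq_argmin (fun m => pairing m r) F0.
exists m, i; split=> // t; apply: mu_diagE => // j hj.
exact/rle/imax.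
Qed.

Lemma lcm_denq_gt0 (gamma : 'rV[rat]_n.+2) :
  (0 < \big[lcmn/1%N]_(j < n.+2) absz (denq (gamma 0%R j)))%N.
Proof.
elim/big_ind: _ => // [x y x0 y0|i _]; first by rewrite lcmn_gt0 x0.
by rewrite absz_gt0 denq_neq0.
Qed.

Lemma vertex_scaled gamma : vertex d gamma -> exists2 r, fundamental_set n d r &
  exists2 c : rat, 0 < c & intr_row r = c *: gamma.
Proof.
move=> [cg eqs_ok]; have [g0 gs gle] := cg.
pose c := \big[lcmn/1%N]_(j < n.+2) absz (denq (gamma 0%R j)).
pose r : 'rV[int]_n.+2 :=
  \row_i ((c %/ `|denq (gamma 0%R i)|)%N%:Z * numq (gamma 0 i)).
have c_gt0 : (0 < c)%N := lcm_denq_gt0 gamma.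
have rE i : (r 0 i)%:~R = c%:R * gamma 0 i.
  have dc : (`|denq (gamma 0%R i)| %| c)%N by exact: (@biglcmn_sup _ i).
  rewrite mxE -[in RHS](divnK dc) natrM rmorphM /= -pmulrn -mulrA; congr (_ * _).
  by rewrite pmulrn absz_denq numqE mulrC.
exists r; last first.
  by exists c%:R; [rewrite ltr0n|apply/rowP => i; rewrite !mxE -rE mxE].
exists gamma; split=> //; split=> //.
have -> : \sum_(i < n.+2 | (1 <= i <= n)%N) gamma 0 i = \sum_(j < n) gamma 0 (inner j).
  rewrite big_mkcond sum_ends /= ltnn add0r addr0.
  by apply: eq_bigr => j _; rewrite /= ltn_ord.
by move: gs; rewrite sum_ends g0; lra.
Qed.

Lemma fundamental_normalized r : fundamental_set n d r -> normalized r.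
Proof.
move=> [gamma [rE [g0 gle _] [eqs [_ [_ gs _] _]]]].
set c := (\big[lcmn/1%N]_(j < n.+2) _ : nat) in rE.
have c_gt0 : (0 < c)%N := lcm_denq_gt0 gamma.
split.
- move=> i j ij; rewrite -(ler_int rat) !rE ler_pM2l ?ltr0n //; exact: gle.
- apply/eqP; rewrite -(intr_eq0 rat) rmorph_sum /=.
  by rewrite (eq_bigr _ (fun i _ => rE i)) -mulr_sumr gs mulr0.
- apply/eqP => r0; have := rE ord0; rewrite r0 mxE g0 mulr1 => /esym/eqP.
  by rewrite pnatr_eq0; lia.
Qed.

Lemma normalized_gt0 r : normalized r -> 0 < r 0 ord0.
Proof.
move=> [rle rs rn0]; rewrite ltNge; apply: contra rn0 => r0.
by apply/eqP/(sorted_sum0_eq0 rle).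
Qed.

Lemma normalized_chamber r : normalized r ->
  chamber (((r 0 ord0)%:~R : rat)^-1 *: intr_row r).
Proof.
move=> nr; have r0 := normalized_gt0 nr; case: nr => rle rs _.
have r0' : 0 < (r 0 ord0)%:~R :> rat by rewrite ltr0z.
split.
- by rewrite !mxE mulVf // gt_eqF.
- under eq_bigr do rewrite !mxE.
  by rewrite -mulr_sumr -rmorph_sum rs mulr0.
- by move=> i j ij; rewrite !mxE ler_pM2l ?invr_gt0 // ler_int rle.
Qed.

(** Let [m] and [i] attain the two minima at [r]. On the closed cell of [r] the
    differences of monomials keep their signs and the coordinates stay sorted, so
    the same [m] and [i] attain the minima throughout: there [mu_diag] is the
    linear function [ell], and it is enough to look at vertices. *)
Lemma fundamental_destabilizes t F h r :
  F \is d.-homog -> F != 0 -> h != 0 -> normalized r ->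
  0 < mu_diag t F h r ->
  exists2 r', fundamental_set n d r' & 0 < mu_diag t F h r'.
Proof.
move=> /dhomogP Fd F0 h0 nr; have [rle _ _] := nr.
have [m [i [mF mmin hi imax ->]]] := mu_diag_attained F0 h0 rle.
pose ell := exponents m + t *: delta_mx 0 i.
have ellE r' : (pairing m r')%:~R + t * (r' 0 i)%:~R = eval_form ell (intr_row r').
  by rewrite eval_formDl eval_formZl eval_delta -pairingE [in RHS]mxE.
rewrite ellE => ell_gt0; have r0 : 0 < (r 0 ord0)%:~R :> rat.
  by rewrite ltr0z; exact: normalized_gt0.
have [gamma [vg ell_le keep]] := vertex_of_cell d ell (normalized_chamber nr).
have [r' fr' [c c_gt0 r'E]] := vertex_scaled vg.
have [r'le _ _] := fundamental_normalized fr'.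
exists r' => //; rewrite (@mu_diagE _ _ _ _ m i) //.
- rewrite ellE r'E eval_formZ mulr_gt0 //; apply: lt_le_trans ell_le.
  by rewrite eval_formZ mulr_gt0 // invr_gt0.
- move=> m' m'F; rewrite -(ler_int rat) !pairingE r'E !eval_formZ ler_pM2l //.
  have [e fe eE] := monomial_difference (Fd _ m'F) (Fd _ mF).
  rewrite -subr_ge0 -eE; apply: (keep _ fe).1.
  by rewrite eval_formZ mulr_ge0 ?invr_ge0 ?(ltW r0) // eE subr_ge0 -!pairingE ler_int mmin.
- by move=> j /imax; exact: r'le.
Qed.

End DiagonalMu.

(** * Changes of coordinates *)

Lemma closed_field_power_neq1 (K : closedFieldType) (a : int) : a != 0 ->
  exists2 s : K, s != 0 & s ^ a != 1.
Proof.
wlog: a / 0 < a => [wl a0|].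
  have [/wl/(_ a0)//|] := ltP 0 a; rewrite le_eqVlt (negPf a0) /= => aneg.
  have [||s s0 sa] := wl (- a); rewrite ?oppr_gt0 ?oppr_eq0 //.
  by exists s => //; apply: contra sa => /eqP sa; rewrite -invr_expz sa invr1.
case: a => // -[|k] // _ _.
(* A solution of [s ^ (k+2) = 1 + s] works: [s ^ (k+1) = 1] would give [s = 1 + s]. *)
have [s sE] := @GRing.solve_monicpoly K k.+2 (fun i => (i <= 1)%N%:R) isT.
move: sE; rewrite !big_ord_recl big1 ?addr0 /= => [|i _]; last by rewrite mul0r.
rewrite !mul1r expr0 expr1 => sE; exists s.
  by apply: contra_eq_neq sE => ->; rewrite exprS mul0r addr0 eq_sym oner_eq0.
apply: contra_eq_neq sE; rewrite -exprnP => sk1; rewrite exprS sk1 mulr1.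
by rewrite -subr_eq0 opprD addrCA subrr addr0 oppr_eq0 oner_eq0.
Qed.

Lemma expz_inj_closed (K : closedFieldType) (a b : int) :
  (forall s : K, s != 0 -> s ^ a = s ^ b) -> a = b.
Proof.
move=> ab; apply/eqP; rewrite -subr_eq0; apply: contraT.
move=> /(@closed_field_power_neq1 K)[s s0].
by rewrite expfzDr // ab // -expfzDr // subrr expr0z eqxx.
Qed.

Section Action.

Variables (K : closedFieldType) (n : nat).
Implicit Types (F : {mpoly K[n.+2]}) (h : 'rV[K]_n.+2) (r : 'rV[int]_n.+2)
  (g c : 'M[K]_n.+2) (rho : K -> 'M[K]_n.+2).

Definition act_var g (i : 'I_n.+2) : {mpoly K[n.+2]} :=
  \sum_(j < n.+2) invmx g i j *: 'X_j.

Lemma act_formE g F : act_form g F =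
  \sum_(m <- msupp F) F@_m *: \prod_i act_var g i ^+ m i.
Proof.
rewrite /act_form comp_mpolyEX; apply: eq_bigr => m _; congr (_ *: _).
by rewrite comp_mpolyX; apply: eq_bigr => i _; rewrite tnth_mktuple.
Qed.

Lemma act_form_is_rmorph g : exists f : {rmorphism {mpoly K[n.+2]} -> {mpoly K[n.+2]}},
  (forall F, f F = act_form g F) /\ forall a F, f (a *: F) = a *: f F.
Proof.
exists (@comp_mpoly n.+2 K n.+2 [tuple act_var g i | i < n.+2]).
by split=> // a F; rewrite /= comp_mpolyZ.
Qed.

Lemma act_formX g i : act_form g 'X_i = act_var g i.
Proof. by rewrite /act_form comp_mpolyXU -tnth_nth tnth_mktuple. Qed.

Lemma act_form_mul c g F : c \in unitmx -> g \in unitmx ->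
  act_form (c *m g) F = act_form c (act_form g F).
Proof.
move=> cu gu; rewrite (act_formE g F).
have [f [fE fZ]] := act_form_is_rmorph c.
rewrite -fE rmorph_sum act_formE; apply: eq_bigr => m _; rewrite fZ rmorph_prod.
congr (_ *: _); apply: eq_bigr => i _; rewrite rmorphXn; congr (_ ^+ _).
rewrite rmorph_sum /=.
under [RHS]eq_bigr => j _ do rewrite fZ fE act_formX scaler_sumr.
rewrite exchange_big; apply: eq_bigr => k _ /=.
have -> : invmx (c *m g) = invmx g *m invmx c by exact: invrM.
by rewrite mxE scaler_suml; apply: eq_bigr => j _; rewrite scalerA.
Qed.

Lemma act_form1 F : act_form 1%:M F = F.
Proof.
rewrite -[RHS]comp_mpoly_id /act_form; congr (_ \mPo _).
apply: eq_from_tnth => i; rewrite !tnth_mktuple (bigD1 i) //= invmx1 mxE eqxx.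
rewrite scale1r big1 ?addr0 // => j /negPf ji.
by rewrite mxE eq_sym ji scale0r.
Qed.

Lemma act_form_neq0 g F : g \in unitmx -> F != 0 -> act_form g F != 0.
Proof.
move=> gu; apply: contra_neq => gF0; rewrite -(act_form1 F) -(mulVmx gu).
by rewrite act_form_mul ?unitmx_inv // gF0 act_formE msupp0 big_nil.
Qed.

Lemma act_hyp_neq0 g h : g \in unitmx -> h != 0 -> act_hyp g h != 0.
Proof.
move=> gu; apply: contra_neq => gh0.
by rewrite -(mulmxKV gu h) -/(act_hyp g h) gh0 mul0mx.
Qed.

Definition weight_ge r (w : int) F : Prop := {in msupp F, forall m, w <= pairing m r}.

Lemma weight_ge_scale r w a F : weight_ge r w F -> weight_ge r w (a *: F).
Proof. by move=> wF m /msuppZ_le; exact: wF. Qed.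

Lemma weight_ge_sum (I : eqType) (s : seq I) (G : I -> {mpoly K[n.+2]}) r w :
  {in s, forall i, weight_ge r w (G i)} -> weight_ge r w (\sum_(i <- s) G i).
Proof.
move=> wG m /msupp_sum_le /flattenP[p /mapP[i]].
by rewrite filter_predT => si -> /(wG i si).
Qed.

Lemma weight_ge_mul r v w F G :
  weight_ge r v F -> weight_ge r w G -> weight_ge r (v + w) (F * G).
Proof.
move=> vF wG m /msuppM_le /allpairsP[[p q] /= [pF qG ->]].
have -> : pairing (p + q)%MM r = pairing p r + pairing q r.
  rewrite /pairing -big_split; apply: eq_bigr => i _ /=.
  by rewrite mnmDE PoszD mulrDl.
by rewrite lerD ?vF ?wG.
Qed.

Lemma weight_ge1 r : weight_ge r 0 1.
Proof.
move=> m; rewrite msupp1 inE => /eqP ->.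
by rewrite /pairing big1 // => i _; rewrite mnm0E mul0r.
Qed.

Lemma weight_ge_exp r w F k : weight_ge r w F -> weight_ge r (k%:Z * w) (F ^+ k).
Proof.
move=> wF; elim: k => [|k IHk]; first by rewrite mul0r expr0; exact: weight_ge1.
by rewrite exprS intS mulrDl mul1r; exact: weight_ge_mul.
Qed.

(** The substitution replaces [x_i] by a combination of variables [x_j] whose
    [r']-weight is at least the [r]-weight of [x_i], and weights add up in
    products. *)
Lemma act_form_weight g F r r' w :
  (forall i j, invmx g i j != 0 -> r 0 i <= r' 0 j) ->
  weight_ge r w F -> weight_ge r' w (act_form g F).
Proof.
move=> grr wF; rewrite act_formE; apply: weight_ge_sum => m mF.
suff mw : weight_ge r' (pairing m r) (\prod_i act_var g i ^+ m i).
  by move=> p /msuppZ_le /mw; exact/le_trans/wF.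
have var_ge i : weight_ge r' (r 0 i) (act_var g i).
  apply: weight_ge_sum => j _ p; have [->|gij] := eqVneq (invmx g i j) 0.
    by rewrite scale0r msupp0.
  rewrite msuppMCX // inE => /eqP ->; rewrite /pairing (bigD1 j) //= mnm1E eqxx.
  by rewrite mul1r big1 ?addr0 ?grr // => k /negPf kj; rewrite mnm1E eq_sym kj mul0r.
rewrite /pairing; elim/big_ind2: _ => [|v1 P1 v2 P2|i _]; first exact: weight_ge1.
  exact: weight_ge_mul.
exact: weight_ge_exp.
Qed.

Lemma pairing_const (m : 'X_{1..n.+2}) (a : int) :
  pairing m (const_mx a) = a * (mdeg m)%:Z.
Proof.
rewrite /pairing mdegE -[Posz _]/(_%:Z) -natz natr_sum mulr_sumr.
by apply: eq_bigr => i _; rewrite mxE mulrC natz.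
Qed.

(** The degree is the weight for [(1, ..., 1)], which any substitution respects
    by [act_form_weight]; using [(-1, ..., -1)] as well bounds it from both
    sides. *)
Lemma act_form_homog g F d : F \is d.-homog -> act_form g F \is d.-homog.
Proof.
move=> /dhomogP Fd; apply/dhomogP => m mF.
have wt a : weight_ge (const_mx a) (a * d%:Z) (act_form g F).
  apply: (@act_form_weight _ _ (const_mx a)) => [i j _|m' m'F]; first by rewrite !mxE.
  by rewrite pairing_const Fd.
have := wt (-1) m mF; have := wt 1 m mF; rewrite !pairing_const !mulN1r !mul1r.
by rewrite lerN2 !lez_nat => le1 le2; apply/eqP; rewrite eqn_leq le2.
Qed.

Lemma det1_unit g : \det g = 1 -> g \in unitmx.
Proof. by move=> dg; rewrite unitmxE dg unitr1. Qed.

Lemma diag_intertwine c r r' i j :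
  (forall s : K, s != 0 -> c *m diag_subgroup r s = diag_subgroup r' s *m c) ->
  c i j != 0 -> r 0 j = r' 0 i.
Proof.
move=> crr cij; apply: (@expz_inj_closed K) => s s0.
have /matrixP/(_ i j) := crr s s0.
rewrite /diag_subgroup mul_mx_diag mul_diag_mx !mxE mulrC.
by move/(mulIf cij).
Qed.

(** The matrix [g *m invmx g'] intertwines the diagonal subgroups of weights
    [r'] and [r], so a nonzero entry in position [(i, j)] forces
    [s ^ r_i = s ^ r'_j] for all [s]. *)
Lemma normalizations_entry rho g g' r r' i j :
  normalizations rho (g, r) -> normalizations rho (g', r') ->
  (g *m invmx g') i j != 0 -> r 0 i = r' 0 j.
Proof.
move=> [/= /det1_unit gu _ gr] [/= /det1_unit g'u _ g'r] gij.
apply/esym/(diag_intertwine _ gij) => s s0.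
rewrite -g'r // -gr // !mulmxA mulmxKV // -!mulmxA; congr (_ *m (_ *m _)).
by rewrite mulKmx // mulmxA.
Qed.

(** By [normalizations_entry], the change of coordinates between two
    normalizations only mixes variables of equal weight, and such a substitution
    cannot lower the minimal weight of a form. *)
Lemma mu_diag_normalizations_le rho g g' r r' t F h : 0 <= t -> F != 0 -> h != 0 ->
  normalizations rho (g, r) -> normalizations rho (g', r') ->
  mu_diag t (act_form g F) (act_hyp g h) r <=
  mu_diag t (act_form g' F) (act_hyp g' h) r'.
Proof.
move=> t0 F0 h0 nr nr'; have rr' i j := @normalizations_entry _ _ _ _ _ i j nr nr'.
have [[/= /det1_unit gu [rle _ _] _] [/= /det1_unit g'u [r'le _ _] _]] := (nr, nr').
have [m0 [i0 [_ mmin _ imax ->]]] :=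
  mu_diag_attained (act_form_neq0 gu F0) (act_hyp_neq0 gu h0) rle.
have [m [i [mF _ hi _ ->]]] :=
  mu_diag_attained (act_form_neq0 g'u F0) (act_hyp_neq0 g'u h0) r'le.
rewrite lerD ?ler_wpM2l ?ler_int //.
  pose c := g' *m invmx g.
  have cu : c \in unitmx by rewrite unitmx_mul g'u unitmx_inv.
  have g'E : g' = c *m g by rewrite mulmxKV.
  have cV : invmx c = g *m invmx g'.
    rewrite -[in RHS](invmxK g); apply: (@invrM _ g' (invmx g)) => //.
    by rewrite -unitmx_inv in gu.
  move: mF; rewrite g'E act_form_mul //; apply: (act_form_weight _ mmin).
  by move=> k l; rewrite cV => /rr' ->.
have [k hk ki] : exists2 k, act_hyp g h 0 k != 0 & (g *m invmx g') k i != 0.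
  have hE : act_hyp g' h = act_hyp g h *m (g *m invmx g').
    by rewrite /act_hyp mulmxA mulmxKV.
  move: hi; rewrite hE mxE => hi; apply: contrapT => nk.
  case/eqP: hi; apply: big1 => k _; apply/eqP; rewrite mulf_eq0.
  by apply/negPn/negP; rewrite negb_or => /andP[? ?]; apply: nk; exists k.
by rewrite -(rr' _ _ ki); exact/rle/imax.
Qed.

Lemma normalizations_mu rho g g' r r' t F h : 0 <= t -> F != 0 -> h != 0 ->
  normalizations rho (g, r) -> normalizations rho (g', r') ->
  mu_diag t (act_form g F) (act_hyp g h) r =
  mu_diag t (act_form g' F) (act_hyp g' h) r'.
Proof.
by move=> t0 F0 h0 nr nr'; apply/le_anti;
  rewrite !(mu_diag_normalizations_le (rho := rho)).
Qed.

Definition conj_subgroup g r (s : K) : 'M[K]_n.+2 :=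
  invmx g *m diag_subgroup r s *m g.

Lemma conj_subgroup_ops g r : \det g = 1 -> normalized r ->
  one_param_subgroup (conj_subgroup g r).
Proof.
move=> dg [_ rs _]; have gu := det1_unit dg.
have diagM (s u : K) : s != 0 -> u != 0 ->
    diag_subgroup r (s * u) = diag_subgroup r s *m diag_subgroup r u.
  move=> s0 u0; rewrite /diag_subgroup mulmx_diag; congr diag_mx.
  by apply/rowP => k; rewrite !mxE expfzMl.
split.
- pose N := (\sum_k `|r 0%R k|)%N.
  have rN k : 0 <= r 0 k + N%:Z.
    have : (`|r 0%R k| <= N)%N by rewrite /N (bigD1 k) //= leq_addr.
    lia.
  exists N, (\matrix_(i, j) \sum_k ((invmx g i k * g k j) *: 'X^(`|(r 0%R k + N%:Z)%R|))).
  move=> s s0 i j; rewrite /conj_subgroup /diag_subgroup mul_mx_diag !mxE.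
  rewrite horner_sum mulr_suml; apply: eq_bigr => k _; rewrite !mxE hornerZ hornerXn.
  rewrite exprnP gez0_abs // expfzDr // -exprnP mulrA mulfK ?expf_neq0 //.
  by rewrite mulrAC.
- move=> s s0; rewrite /conj_subgroup !det_mulmx det_inv dg invr1 mul1r mulr1.
  rewrite det_diag; under eq_bigr do rewrite mxE.
  suff -> : \prod_i s ^ r 0 i = s ^ (\sum_i r 0 i) by rewrite rs expr0z.
  by elim/big_rec2: _ => [|i a b _ ->]; rewrite ?expr0z // expfzDr.
move=> s u s0 u0; rewrite /conj_subgroup diagM // !mulmxA.
by congr (_ *m _ *m _); rewrite mulmxK.
Qed.

Lemma conj_subgroup_normalization g r : \det g = 1 -> normalized r ->
  normalizations (conj_subgroup g r) (g, r).
Proof.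
move=> dg nr; split=> //= s s0; rewrite /conj_subgroup.
by rewrite !mulmxA mulmxV ?det1_unit // mul1mx mulmxK ?det1_unit.
Qed.

Lemma conj_subgroup_nontrivial g r : \det g = 1 -> normalized r ->
  nontrivial (conj_subgroup g r).
Proof.
move=> dg nr; have := normalized_gt0 nr; rewrite lt_neqAle eq_sym => /andP[r0 _].
have [s s0 sr] := @closed_field_power_neq1 K _ r0; exists s => // rho1.
have [_ _ /(_ s s0)] := conj_subgroup_normalization dg nr.
rewrite /= rho1 mulmx1 mulmxV ?det1_unit // => /matrixP/(_ ord0 ord0)/esym/eqP.
by rewrite !mxE eqxx mulr1n; exact/negP.
Qed.

End Action.

(** * Semistability as a finite system of inequalities *)

Section Criterion.

Variables (K : closedFieldType) (n d : nat).
Implicit Types (P : pair K n d) (g : 'M[K]_n.+2) (r : 'rV[int]_n.+2) (t : rat).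

Definition mu_at t P g r : rat :=
  mu_diag t (act_form g (Defs.form P)) (act_hyp g (hyp P)) r.

Lemma mu_conj t P g r : 0 <= t -> \det g = 1 -> normalized r ->
  mu t P (conj_subgroup g r) = mu_at t P g r.
Proof.
move=> t0 dg nr; rewrite /mu /mu_at.
have := xgetI (1%:M, 0) (conj_subgroup_normalization dg nr).
case: (xget _ _) => g' r' nr'.
apply: normalizations_mu t0 (form_neq0 P) (hyp_neq0 P) nr' _.
exact: conj_subgroup_normalization.
Qed.

Lemma seq_min_eq0 (s : seq int) : {in s, forall x, x = 0} -> seq_min s = 0.
Proof.
move=> s0; have [+ _] := bigmin_mem_le (head 0 s) s; rewrite -/(seq_min s).
case: s s0 => [|x s] s0; first by rewrite mem_seq1 => /eqP.
by rewrite inE => /orP[/eqP->|/s0 //]; exact/s0/mem_head.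
Qed.

Lemma mu_diag0 t (F : {mpoly K[n.+2]}) (h : 'rV[K]_n.+2) : mu_diag t F h 0 = 0.
Proof.
rewrite /mu_diag !seq_min_eq0 ?mulr0 ?addr0 // => [y /mapP[i _ ->]|y /mapP[m _ ->]].
  by rewrite mxE.
by rewrite /pairing big1 // => i _; rewrite mxE mulr0.
Qed.

Lemma semistable_mu_at t P : 0 <= t -> semistable t P ->
  forall g r, \det g = 1 -> normalized r -> mu_at t P g r <= 0.
Proof.
move=> t0 ss g r dg nr; rewrite -mu_conj //; apply: ss.
  exact: conj_subgroup_ops.
exact: conj_subgroup_nontrivial.
Qed.

Lemma stable_mu_at t P : 0 <= t -> stable t P ->
  forall g r, \det g = 1 -> normalized r -> mu_at t P g r < 0.
Proof.
move=> t0 st g r dg nr; rewrite -mu_conj //; apply: st.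
  exact: conj_subgroup_ops.
exact: conj_subgroup_nontrivial.
Qed.

(** For a normalizable subgroup this is [fundamental_destabilizes]; a subgroup
    without normalization would have [mu] equal to [0], the value given by the
    default weights, and so would satisfy the inequality too. *)
Lemma semistable_of_fundamental t P :
  (forall g r, \det g = 1 -> fundamental_set n d r -> mu_at t P g r <= 0) ->
  semistable t P.
Proof.
move=> fund rho _ _; rewrite /mu.
case: xgetP => [[g r] _ [/= dg nr _]|_]; last by rewrite mu_diag0.
have gu := det1_unit dg; rewrite leNgt; apply/negP => mu_gt0.
have [r' fr'] := fundamental_destabilizes (act_form_homog g (form_homog P))
  (act_form_neq0 gu (form_neq0 P)) (act_hyp_neq0 gu (hyp_neq0 P)) nr mu_gt0.
by rewrite ltNge fund.
Qed.

(** A fundamental subgroup is determined by the [n] equations that single it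
    out, and these come from a finite list. *)
Lemma fundamental_set_finite : finite_set (fundamental_set n d).
Proof.
have [Phi PhiP] := fundamental_equations_finite n d.
pose defines (e : {ffun 'I_n -> seq_sub Phi}) r := exists gamma : 'rV[rat]_n.+2,
  [/\ forall i, (r 0 i)%:~R =
        (\big[lcmn/1%N]_(j < n.+2) absz (denq (gamma 0%R j)))%:R * gamma 0 i,
      solves (fun k => val (e k)) gamma &
      forall gamma', solves (fun k => val (e k)) gamma' -> gamma' = gamma].
apply: sub_finite_set (finite_image (fun e => xget 0 [set r | defines e r]%classic)
  (@finite_finset _ setT)) => r [gamma [rE _ [eqs [eqsf sol uniq_sol]]]].
have eqsPhi k : eqs k \in Phi by apply/PhiP.
exists [ffun k => SeqSub (eqsPhi k)] => //.
have eE gamma' : solves (fun k => val ([ffun k => SeqSub (eqsPhi k)] k)) gamma' <->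
    solves eqs gamma'.
  by split=> -[? ? kE]; split=> // k; have := kE k; rewrite ffunE.
apply: xget_unique => /=.
  by exists gamma; split=> //; [apply/eE|move=> gamma' /eE/uniq_sol].
move=> r' [gamma' [r'E /eE/uniq_sol gE _]].
by apply/rowP => i; apply: (@intr_inj rat); rewrite r'E rE gE.
Qed.

(** The coefficients [(A, B)] of all inequalities [A + t * B <= 0] that can
    occur for some pair; the candidate walls are the zeros of the nonconstant
    functions [A + t * B]. *)
Definition weight_pairs : set (rat * rat) :=
  [set p | exists m : 'X_{1..n.+2}, exists i r,
    [/\ mdeg m = d, fundamental_set n d r & p = ((pairing m r)%:~R, (r 0 i)%:~R)]]%classic.

Lemma weight_pairs_finite : finite_set weight_pairs.
Proof.
have fin := finite_image2 (fun (m : 'X_{1..n.+2}) (ir : 'I_n.+2 * 'rV[int]_n.+2) =>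
   ((pairing m ir.2)%:~R, (ir.2 0 ir.1)%:~R) : rat * rat) (monomials_finite n d)
   (finite_setX (@finite_finset _ setT) fundamental_set_finite).
apply: sub_finite_set fin => _ [m [i [r [dm fr ->]]]].
by exists m => //; exists (i, r).
Qed.

Lemma candidate_wallsE q : candidate_walls n d q <->
  exists2 p, weight_pairs p & p.2 != 0 /\ q = - (p.1 / p.2).
Proof.
split=> [[m [i [r [dm fr ri ->]]]]|[_ [m [i [r [dm fr ->]]]] [/= ri ->]]].
  exists ((pairing m r)%:~R, (r 0 i)%:~R); first by exists m, i, r.
  by rewrite intr_eq0.
by exists m, i, r; split=> //; rewrite intr_eq0 in ri.
Qed.

Lemma candidate_walls_finite : finite_set (candidate_walls n d).
Proof.
apply: sub_finite_set (finite_image (fun p => - (p.1 / p.2)) weight_pairs_finite).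
by move=> q /candidate_wallsE[p pw [_ ->]]; exists p.
Qed.

(** For fixed [g] and [r], the function [t |-> mu_at t P g r] is affine with
    coefficients in the finite set [weight_pairs], so the infinitely many
    conditions on [t], one for each [g] and [r], amount to finitely many. *)
Lemma semistable_inequalities P : exists E : seq (rat * rat),
  [/\ {in E, forall p, weight_pairs p},
      forall t, 0 <= t -> semistable t P <-> {in E, forall p, p.1 + t * p.2 <= 0}
    & forall t, 0 <= t -> stable t P -> {in E, forall p, p.1 + t * p.2 < 0}].
Proof.
pose A : set (rat * rat) := [set p | weight_pairs p /\ exists g r,
  [/\ \det g = 1, normalized r & forall t, mu_at t P g r = p.1 + t * p.2]]%classic.
have /finite_seqP[E AE] : finite_set A.
  by apply: sub_finite_set weight_pairs_finite => p [].
have EP p : p \in E <-> A p by rewrite AE.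
exists E; split=> [p /EP[]//|t t0|t t0 st p /EP[_ [g [r [dg nr <-]]]]]; last first.
  exact: stable_mu_at.
split=> [ss p /EP[_ [g [r [dg nr <-]]]]|ineqs]; first exact: semistable_mu_at.
apply: semistable_of_fundamental => g r dg fr; have nr := fundamental_normalized fr.
have [rle _ _] := nr; have gu := det1_unit dg.
have [m [i [mF _ hi _ muE]]] := mu_diag_attained
  (act_form_neq0 gu (form_neq0 P)) (act_hyp_neq0 gu (hyp_neq0 P)) rle.
rewrite /mu_at muE; apply: (ineqs ((pairing m r)%:~R, (r 0 i)%:~R)); apply/EP; split.
  exists m, i, r; split=> //.
  by have /dhomogP/(_ _ mF) := act_form_homog g (form_homog P).
by exists g, r.
Qed.

(** The extended row basis of [h] takes [h] to a multiple of the first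
    coordinate; rescaling its last row corrects the determinant without
    disturbing this, as there are at least two coordinates. *)
Lemma straighten_hyperplane (h : 'rV[K]_n.+2) : exists2 g, \det g = 1 &
  forall j, act_hyp g h 0 j != 0 -> j = ord0.
Proof.
pose G := row_ebase h; pose X := col_ebase h *m pid_mx (\rank h) : 'rV[K]_n.+2.
have Gu : G \in unitmx := row_ebase_unit h.
have X0 j : X 0 j != 0 -> j = ord0.
  rewrite mxE big_ord1 mxE; case: j => -[|j] jn //=; first by move=> _; apply/val_inj.
  by rewrite mulr0 eqxx.
pose D : 'M[K]_n.+2 := diag_mx (\row_i if i == ord_max then (\det G)^-1 else 1).
have detD : \det D = (\det G)^-1.
  rewrite det_diag (bigD1 ord_max) //= mxE eqxx big1 ?mulr1 // => i /negPf iM.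
  by rewrite mxE iM.
have detG : \det G != 0 by move: Gu; rewrite unitmxE unitfE.
have detg : \det (D *m G) = 1 by rewrite det_mulmx detD mulVf.
exists (D *m G) => // j; rewrite /act_hyp.
have -> : h = X *m (D *m G).
  rewrite -[LHS]mulmx_ebase mulmxA; congr (_ *m _); apply/rowP => k.
  rewrite mul_mx_diag [RHS]mxE [X in _ * X]mxE -/X.
  have [->|/X0 ->] := eqVneq (X 0 k) 0; first by rewrite mul0r.
  by rewrite mulr1.
by rewrite mulmxK ?det1_unit //; exact: X0.
Qed.

(** When [H] is the hyperplane [x_0 = 0], the subgroup of weights
    [(n+1, -1, ..., -1)] gives at least [-d + t * (n+1)]. *)
Lemma unstable_above t P : t_max rat n d < t -> ~ semistable t P.
Proof.
move=> td; have t0 : 0 <= t by apply/ltW/(le_lt_trans _ td); rewrite divr_ge0 ?ler0n.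
move=> /(semistable_mu_at t0) ss; have [g dg g0] := straighten_hyperplane (hyp P).
pose r : 'rV[int]_n.+2 := \row_i if i == ord0 then n.+1%:Z else -1.
have r_gt i : -1 <= r 0 i by rewrite mxE; case: ifP.
have nr : normalized r.
  split; last by apply/eqP => /rowP/(_ ord0); rewrite !mxE.
    move=> i j ij; rewrite [r 0 j]mxE; case: eqP => // j0.
    move: ij; rewrite j0 leqn0 => i0.
    by rewrite mxE (_ : i == ord0).
  rewrite big_ord_recl mxE eqxx (eq_bigr (fun=> -1)) => [|i _]; last by rewrite mxE.
  by rewrite sumr_const card_ord mulNrn natz subrr.
have [rle _ _] := nr; have gu := det1_unit dg.
have [m [i [mF _ /g0 -> _ muE]]] := mu_diag_attained
  (act_form_neq0 gu (form_neq0 P)) (act_hyp_neq0 gu (hyp_neq0 P)) rle.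
have := ss g r dg nr; rewrite /mu_at muE [r 0 ord0]mxE eqxx leNgt => /negP; apply.
have : - d%:Z <= pairing m r.
  have /dhomogP/(_ _ mF) <- := act_form_homog g (form_homog P).
  rewrite -mulN1r -pairing_const /pairing; apply: ler_sum => k _.
  by rewrite mxE ler_wpM2l.
rewrite -(ler_int rat) rmorphN /= -!pmulrn => md.
move: td; rewrite /t_max ltr_pdivrMr ?ltr0n //.
by rewrite -(ltrD2l (- d%:R)) addrC subrr => /lt_le_trans; apply; rewrite lerD2r.
Qed.

End Criterion.

(** * The extreme walls are candidates *)

Section SpecialCandidates.

Variables (n d : nat).
Hypothesis d_gt0 : (0 < d)%N.
Implicit Types (gamma : 'rV[rat]_n.+2).

Lemma vertex_candidate gamma (m : 'X_{1..n.+2}) i :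
  vertex d gamma -> mdeg m = d -> gamma 0 i != 0 ->
  candidate_walls n d (- (eval_form (exponents m) gamma / gamma 0 i)).
Proof.
move=> /vertex_scaled[r fr [c c_gt0 rE]] dm gi.
have riE : (r 0 i)%:~R = c * gamma 0 i by have /rowP/(_ i) := rE; rewrite !mxE.
exists m, i, r; split=> //.
  by rewrite -(intr_eq0 rat) riE mulf_neq0 // gt_eqF.
by rewrite pairingE rE riE eval_formZ -mulf_div divff ?mul1r // gt_eqF.
Qed.

Lemma eval_exponentsD (m m' : 'X_{1..n.+2}) gamma :
  eval_form (exponents (m + m')%MM) gamma =
  eval_form (exponents m) gamma + eval_form (exponents m') gamma.
Proof.
rewrite -eval_formDl; congr eval_form; apply/rowP => i.
by rewrite !mxE mnmDE natrD.
Qed.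

Lemma eval_exponents_pow i k gamma :
  eval_form (exponents (U_(i) *+ k)%MM) gamma = k%:R * gamma 0 i.
Proof.
rewrite -eval_delta -eval_formZl; congr eval_form; apply/rowP => j.
by rewrite !mxE mulmnE mnm1E eqxx /= natrM mulrC eq_sym.
Qed.

Lemma mdeg_pow i k : mdeg (U_(i) *+ k : 'X_{1..n.+2})%MM = k.
Proof. by rewrite mdegMn mdeg1 mul1n. Qed.

(** The form [x_i ^ d - x_j ^ d] of the arrangement evaluates to [d] times the
    difference of the two coordinates. *)
Lemma same_cell_eq gamma gamma' i j :
  (forall e, fundamental_equation d e ->
    keeps_sign (eval_form e gamma) (eval_form e gamma')) ->
  gamma 0 i = gamma 0 j -> gamma' 0 i = gamma' 0 j.
Proof.
move=> keep gij; have [e fe eE] := monomial_difference (mdeg_pow i d) (mdeg_pow j d).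
have /keeps_sign0 := keep e fe; rewrite !eE !eval_exponents_pow gij subrr => /(_ erefl).
rewrite -mulrBr => /eqP; rewrite mulf_eq0 pnatr_eq0 -[(_ == _)%N]negbK -lt0n d_gt0 /=.
by rewrite subr_eq0 => /eqP.
Qed.

(** The vector [(1, ..., 1, - (n+1))] is pinned down by equalities between
    coordinates, which persist on its closed cell; hence it is a vertex. Its
    value comes from [m = x_0 ^ d] and the last coordinate. *)
Lemma t_max_candidate : candidate_walls n d (t_max rat n d).
Proof.
pose gamma : 'rV[rat]_n.+2 := \row_i if i == ord_max then - n.+1%:R else 1.
have gin j : gamma 0 (inner j) = 1.
  by rewrite mxE; case: eqP => // /(congr1 val) /=; have := ltn_ord j; rewrite /bump /=; lia.
have cg : chamber gamma.
  split; first by rewrite mxE.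
    rewrite sum_ends (eq_bigr _ (fun j _ => gin j)) !mxE eqxx /= sumr_const card_ord.
    by rewrite -(natr1 n); ring.
  move=> i j ij; rewrite !mxE; case: (eqVneq i ord_max) => [iM|_].
    suff -> : j = ord_max by rewrite eqxx.
    by apply/val_inj/anti_leq; move: ij; rewrite iM => ->; rewrite andbT leq_ord.
  by case: ifP => // _; rewrite -subr_ge0 opprK addr_ge0 ?ler0n.
(* Only the closed cell matters, so the linear function to be increased is zero. *)
have [gamma' [vg' _ keep]] := vertex_of_cell d 0 cg.
have [[g'0 g's _] _] := vg'.
have g'max : gamma' 0 ord_max = - n.+1%:R.
  have g'in j : gamma' 0 (inner j) = 1.
    by rewrite -g'0; apply: same_cell_eq keep _; rewrite gin mxE.
  move: g's; rewrite sum_ends (eq_bigr _ (fun j _ => g'in j)) g'0 sumr_const card_ord.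
  by rewrite -(natr1 n); lra.
have := @vertex_candidate gamma' (U_(ord0) *+ d)%MM ord_max vg' (mdeg_pow _ _).
rewrite eval_exponents_pow g'0 g'max mulr1 oppr_eq0 pnatr_eq0 => /(_ isT).
by rewrite invrN mulrN opprK.
Qed.

(** Likewise for [(1, 0, ..., 0, -1)], with one more form that vanishes there:
    the difference of [x_0 x_1 ^ (d-2) x_(n+1)] and [x_1 ^ d], which exists
    because [d >= 2] and [n >= 1]. The first of these monomials has weight zero
    at the vertex. *)
Lemma zero_candidate : (1 <= n)%N -> (2 <= d)%N -> candidate_walls n d 0.
Proof.
move=> n_gt0 d_gt1; pose gamma : 'rV[rat]_n.+2 :=
  \row_i if i == ord0 then 1 else if i == ord_max then - 1 else 0.
have gin j : gamma 0 (inner j) = 0.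
  rewrite mxE; case: eqP => [/(congr1 val) //|_].
  by case: eqP => // /(congr1 val) /=; have := ltn_ord j; rewrite /bump /=; lia.
have gmax : gamma 0 ord_max = -1 by rewrite mxE eqxx.
have g0 : gamma 0 ord0 = 1 by rewrite mxE eqxx.
have cg : chamber gamma.
  split=> //.
    by rewrite sum_ends (eq_bigr _ (fun j _ => gin j)) g0 gmax big1 // add0r subrr.
  move=> i j ij; rewrite !mxE; have [i0|i0] := eqVneq i ord0.
    by case: ifP => // _; case: ifP.
  have [j0|_] := eqVneq j ord0.
    by case/eqP: i0; apply/val_inj/eqP; rewrite -leqn0; move: ij; rewrite j0.
  have [iM|_] := eqVneq i ord_max; last by case: ifP.
  suff -> : j = ord_max by rewrite eqxx.
  by apply/val_inj/anti_leq; move: ij; rewrite iM => ->; rewrite andbT leq_ord.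
(* Only the closed cell matters, so the linear function to be increased is zero. *)
have [gamma' [vg' _ keep]] := vertex_of_cell d 0 cg.
have [[g'0 g's _] _] := vg'.
pose i1 := inner (Ordinal n_gt0).
pose m := (U_(ord0) *+ 1 + (U_(ord_max) *+ 1 + U_(i1) *+ (d - 2)) : 'X_{1..n.+2})%MM.
have dm : mdeg m = d by rewrite /m !mdegD !mdeg_pow; lia.
have mE g : eval_form (exponents m) g = g 0 ord0 + (g 0 ord_max + (d - 2)%:R * g 0 i1).
  by rewrite /m !eval_exponentsD !eval_exponents_pow !mul1r.
have g'in j : gamma' 0 (inner j) = gamma' 0 i1.
  by apply: same_cell_eq keep _; rewrite !gin.
have g'max : 1 + gamma' 0 ord_max = 2 * gamma' 0 i1.
  have [e fe eE] := monomial_difference dm (mdeg_pow i1 d).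
  have /keeps_sign0 := keep e fe; rewrite !eE !mE !eval_exponents_pow g0 gmax gin g'0.
  rewrite !mulr0 addr0 !subrr => /(_ erefl).
  by rewrite natrB //; lra.
have g'1 : gamma' 0 i1 = 0.
  move: g's; rewrite sum_ends (eq_bigr _ (fun j _ => g'in j)) g'0 sumr_const card_ord.
  rewrite addrCA g'max -[_ *+ n]mulr_natl -mulrDl => /eqP; rewrite mulf_eq0 => /orP[|/eqP //].
  by rewrite -natrD pnatr_eq0 addnS.
have := @vertex_candidate gamma' m ord0 vg' dm; rewrite mE g'0 g'1 mulr0 addr0 oner_eq0.
by rewrite g'max g'1 mulr0 mul0r oppr0; apply.
Qed.

End SpecialCandidates.

(** Each inequality bounds [t] on one side, so the solutions are cut out by the
    smallest upper bound and the largest lower bound; writing [0 <= t] as the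
    inequality of the pair [(0, -1)] makes the two sides alike. *)
Lemma half_lines_interval (F : realFieldType) (E : seq (F * F)) (M : F) :
  (forall t, 0 <= t -> {in E, forall p, p.1 + t * p.2 <= 0} -> t <= M) ->
  (forall t, 0 <= t -> ~ {in E, forall p, p.1 + t * p.2 <= 0}) \/
  exists a b, [/\ 0 <= a, a <= b,
    forall t, 0 <= t -> ({in E, forall p, p.1 + t * p.2 <= 0} <-> a <= t <= b),
    a = 0 \/ (exists2 p, p \in E & p.1 + a * p.2 = 0)
    & exists2 p, p \in E & p.1 + b * p.2 = 0].
Proof.
move=> bound.
have [[t0 [t0_ge0 t0E]]|none] :=
    pselect (exists t, 0 <= t /\ {in E, forall p, p.1 + t * p.2 <= 0}); last first.
  by left=> t t0 tE; apply: none; exists t.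
right.
pose root (p : F * F) := - p.1 / p.2.
have rootE p : p.2 != 0 -> p.1 + root p * p.2 = 0 by move=> p0; rewrite /root; field.
pose upper := [seq p <- E | 0 < p.2]; pose lower := [seq p <- (0, -1) :: E | p.2 < 0].
have ineq_pos x t : 0 < x.2 -> (x.1 + t * x.2 <= 0) = (t <= root x).
  by move=> x2; rewrite /root ler_pdivlMr // -subr_ge0 -[RHS]subr_ge0 sub0r opprD.
have ineq_neg x t : x.2 < 0 -> (x.1 + t * x.2 <= 0) = (root x <= t).
  by move=> x2; rewrite /root ler_ndivrMr // -subr_ge0 -[RHS]subr_ge0 sub0r opprD.
have upper0 : upper != [::].
  apply/eqP => up0; have := bound (t0 + `|M| + 1).
  have := ler_norm M; have := normr_ge0 M; move=> M0 leM.
  have t1_ge0 : 0 <= t0 + `|M| + 1 by lra.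
  move=> /(_ t1_ge0) tM; suff : t0 + `|M| + 1 <= M by lra.
  apply: tM => p pE; have := t0E p pE; have : p.2 <= 0.
    rewrite leNgt; apply/negP => p2; have : p \in upper by rewrite mem_filter p2.
    by rewrite up0.
  by nra.
have lower0 : lower != [::] by rewrite /lower /= oppr_lt0 ltr01.
have [p] := seq_argmin root upper0; rewrite mem_filter => /andP[p2 pE] pmin.
have [q] := seq_argmin (fun q => - root q) lower0; rewrite mem_filter => /andP[q2 qE] qmax.
have root0 : root (0, -1) = 0 by rewrite /root /= oppr0 mul0r.
have q_ge0 : 0 <= root q.
  by have := qmax (0, -1); rewrite root0 lerN2 mem_filter /= oppr_lt0 ltr01 mem_head; apply.
have TE t : 0 <= t ->
    {in E, forall p, p.1 + t * p.2 <= 0} <-> root q <= t <= root p.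
  move=> t_ge0; split=> [tE|/andP[qt tp] x xE].
    rewrite -(ineq_pos _ _ p2) tE // andbT.
    move: qE; rewrite inE => /orP[/eqP->|qE]; first by rewrite root0.
    by rewrite -(ineq_neg _ _ q2) tE.
  have [x2|x2|x2] := ltgtP x.2 0.
  - rewrite ineq_neg //; apply: le_trans qt; rewrite -lerN2 qmax // mem_filter x2.
    by rewrite inE xE orbT.
  - by rewrite ineq_pos //; apply: le_trans tp _; rewrite pmin // mem_filter x2.
  - by have := t0E x xE; rewrite x2 !mulr0.
exists (root q), (root p); split=> //.
- by have /TE-/(_ t0_ge0)/andP[] := t0E; exact: le_trans.
- move: qE; rewrite inE => /orP[/eqP->|qE]; first by left; rewrite root0.
  by right; exists q => //; rewrite rootE // lt_eqF.
- by exists p => //; rewrite rootE // gt_eqF.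
Qed.

(** * Walls *)

Section Walls.

Variables (K : closedFieldType) (R : archiRealFieldType) (n d : nat).
Implicit Types (P : pair K n d).

Lemma small_rat (eps : R) : 0 < eps -> exists2 delta : rat, 0 < delta & ratr delta < eps.
Proof.
move=> eps0; have lt_bound := archi_boundP (ltW (_ : 0 < eps^-1)).
have {lt_bound} := lt_bound; rewrite invr_gt0 => /(_ eps0).
set N := Num.bound _ => eN; have N0 : 0 < N%:R :> R.
  by apply: le_lt_trans eN; rewrite invr_ge0 ltW.
exists N%:R^-1; first by rewrite invr_gt0 ltr0n -(ltr0n R).
by rewrite fmorphV /= ratr_nat -[eps]invrK ltf_pV2 // posrE invr_gt0.
Qed.

Lemma t_max_ratr : ratr (t_max rat n d) = t_max R n d.
Proof. by rewrite /t_max fmorph_div /= !ratr_nat. Qed.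

Lemma wall_of_change P (a : rat) : 0 < a -> semistable a P ->
  (forall delta, 0 < delta -> exists2 q : rat, 0 <= q &
     `|q - a| < delta /\ ~ semistable q P) ->
  git_walls K R n d (ratr a).
Proof.
move=> a0 ssa change; right; right; split=> [|eps eps0 const]; first by rewrite ltr0q.
have [delta delta0 lt_eps] := small_rat eps0.
have [q q0 [qa nss]] := change delta delta0.
have qa' : `|ratr q - ratr a| < eps :> R.
  by rewrite -rmorphB -ratr_norm (lt_trans _ lt_eps) // ltr_rat.
have aa : `|ratr a - ratr a| < eps :> R by rewrite subrr normr0.
have /(congr1 (fun A => A P)) := const q a q0 (ltW a0) qa' aa.
by rewrite /semistable_pairs /= => eq; apply: nss; rewrite eq.
Qed.

(** If some inequality holds at one of [q], [q'] but not at the other, its zero,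
    which is a candidate wall, does not lie strictly on one side of both. *)
Lemma semistable_no_candidate (q q' : rat) : 0 <= q -> 0 <= q' ->
  (forall c, candidate_walls n d c -> (c - q) * (c - q') > 0) ->
  semistable_pairs K n d q = semistable_pairs K n d q'.
Proof.
have imp u v : 0 <= u -> 0 <= v ->
    (forall c, candidate_walls n d c -> (c - u) * (c - v) > 0) ->
    forall P, semistable u P -> semistable v P.
  move=> u0 v0 sep P; have [E [EW ssE _]] := semistable_inequalities P.
  move=> /(ssE u u0) uE; apply/(ssE v v0) => p pE.
  have pu := uE p pE; rewrite leNgt; apply/negP => pv.
  have p2 : p.2 != 0 by apply: contraTneq pv => p2; rewrite -leNgt; move: pu; rewrite p2 !mulr0.
  have cand : candidate_walls n d (- (p.1 / p.2)).
    by apply/candidate_wallsE; exists p; [exact: EW|split].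
  have rootE : (- (p.1 / p.2) - u) * (- (p.1 / p.2) - v) =
      (p.1 + u * p.2) * (p.1 + v * p.2) / p.2 ^+ 2 by field.
  have := sep _ cand; rewrite rootE.
  by rewrite pmulr_lgt0 ?invr_gt0 ?exprn_even_gt0 // pmulr_lgt0 // ltNge pu.
move=> q0 q'0 sep; apply/funext => P; apply/propext; split; apply: imp => // c /sep.
by rewrite mulrC.
Qed.

(** The candidates form a finite set; if [t] is not among them, it has a
    neighbourhood without candidates, and there the set of semistable pairs is
    constant. *)
Lemma positive_wall_candidate (t : R) : 0 < t ->
  (forall eps : R, 0 < eps -> ~ (forall q q' : rat, 0 <= q -> 0 <= q' ->
     `|ratr q - t| < eps -> `|ratr q' - t| < eps ->
     semistable_pairs K n d q = semistable_pairs K n d q')) ->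
  exists2 q : rat, candidate_walls n d q & t = ratr q.
Proof.
move=> t0 change; apply: contrapT => ncand.
have /finite_seqP[C CE] := candidate_walls_finite n d.
have CP c : c \in C <-> candidate_walls n d c by rewrite CE.
have far c : c \in C -> 0 < `|ratr c - t|.
  by move=> /CP cc; rewrite normr_gt0 subr_eq0; apply/eqP => ct; apply: ncand; exists c.
have [eps eps0 epsC] : exists2 eps : R, 0 < eps & {in C, forall c, eps <= `|ratr c - t|}.
  have [C0|/(seq_argmin (fun c => `|ratr c - t|))[c cC cmin]] := eqVneq C [::].
    by exists 1 => //; rewrite C0.
  by exists `|ratr c - t| => //; exact: far.
apply: (change eps eps0) => q q' q0 q'0 qt q't.
apply: semistable_no_candidate => // c /CP/epsC.
rewrite -(ltr0q R) rmorphM !rmorphB /=.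
move: (ratr c) (ratr q) (ratr q') qt q't => x y y'.
rewrite !ltr_norml ler_normr => /andP[? ?] /andP[? ?] /orP[?|?]; nra.
Qed.

Lemma wall_le_t_max (t : R) : git_walls K R n d t -> 0 <= t <= t_max R n d.
Proof.
have tm : 0 <= t_max R n d by rewrite divr_ge0 ?ler0n.
move=> [->|[->|[t0 change]]]; rewrite ?lexx ?tm //.
rewrite (ltW t0) leNgt; apply/negP => t_gt.
have eps0 : 0 < t - t_max R n d by rewrite subr_gt0.
apply: (change _ eps0) => q q' q0 q'0 qt q't.
have above s : `|ratr s - t| < t - t_max R n d -> forall P, ~ semistable s P.
  rewrite ltr_norml => /andP[st _] P; apply: unstable_above.
  by rewrite -(ltr_rat R) t_max_ratr; lra.
apply/funext => P; apply/propext; split=> [/(above _ qt)|/(above _ q't)] //.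
Qed.

End Walls.

Theorem theorem1p1 (K : closedFieldType) (R : archiRealFieldType) (n d : nat)
    (hn : (1 <= n)%N) (hd : (1 <= d)%N) :
  [/\ finite_set (candidate_walls n d),
      (forall t : R, git_walls K R n d t ->
         (exists2 q : rat, candidate_walls n d q & t = ratr q)
         \/ (d = 1%N /\ t = 0)),
      (forall t : R, git_walls K R n d t -> 0 <= t <= t_max R n d)
    & forall P : pair K n d,
        (forall t : rat, 0 <= t -> ~ semistable t P)
        \/ exists a b : R,
             [/\ git_walls K R n d a, git_walls K R n d b, a <= b,
                 (forall t : rat, 0 <= t ->
                    (semistable t P <-> a <= ratr t <= b))
               & (exists2 t : rat, 0 <= t & stable t P) ->
                 forall t : rat, 0 <= t -> ~ (t = 0 /\ a = 0) ->
                   (stable t P <-> a < ratr t < b)]].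
Proof.
split; [exact: candidate_walls_finite| |exact: wall_le_t_max|].
  move=> t [->|[->|[t0]]]; last by move/(positive_wall_candidate t0); left.
    case: (leqP 2 d) => d2; last by right; split=> //; lia.
    by left; exists 0; [exact: zero_candidate|rewrite rmorph0].
  by left; exists (t_max rat n d); rewrite ?t_max_ratr //; exact: t_max_candidate.
move=> P; have [E [_ ssE stE]] := semistable_inequalities P.
have [||[a [b [a0 ab TE alow bup]]]] := @half_lines_interval _ E (t_max rat n d).
- move=> t t0 tE; rewrite leNgt; apply/negP => /(@unstable_above K _ _ _ P); apply.
  exact/ssE.
- by move=> none; left=> t t0 /(ssE t t0); exact: none.
have b0 := le_trans a0 ab.
have ss_ab t : 0 <= t -> semistable t P <-> a <= t <= b.
  by move=> t0; split=> [/(ssE t t0)/(TE t t0)|/(TE t t0)/(ssE t t0)].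
have ssa : semistable a P by apply/ss_ab; rewrite ?lexx.
have ssb : semistable b P by apply/ss_ab; rewrite ?lexx ?ab.
right; exists (ratr a), (ratr b); split; rewrite ?ler_rat //.
(* Just below [a > 0] the pair is not semistable, so [a] is a wall; the maximum
   keeps the test point nonnegative. *)
- have [->|an0] := eqVneq a 0; first by left; rewrite rmorph0.
  have a_gt0 : 0 < a by rewrite lt_neqAle eq_sym an0.
  apply: wall_of_change ssa _ => // delta delta0.
  have q0 : 0 <= Num.max 0 (a - delta / 2) by rewrite le_max lexx.
  exists (Num.max 0 (a - delta / 2)) => //.
  have lt_a : Num.max 0 (a - delta / 2) < a.
    by rewrite gt_max a_gt0 /=; lra.
  have gt_a : a - delta / 2 <= Num.max 0 (a - delta / 2) by rewrite le_max lexx orbT.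
  split; first by rewrite ltr_norml; apply/andP; split; lra.
  by move=> /(ss_ab _ q0)/andP[]; rewrite leNgt lt_a.
- have [->|bn0] := eqVneq b 0; first by left; rewrite rmorph0.
  have b_gt0 : 0 < b by rewrite lt_neqAle eq_sym bn0.
  apply: wall_of_change ssb _ => // delta delta0.
  have q0 : 0 <= b + delta / 2 by lra.
  exists (b + delta / 2) => //.
  split; first by rewrite addrAC subrr add0r ger0_norm; lra.
  by move=> /(ss_ab _ q0)/andP[_]; lra.
- by move=> t t0; rewrite !ler_rat; exact: ss_ab.
move=> [t1 t1_ge0 st1] t t0 not00; rewrite !ltr_rat.
have t1ab : a <= t1 <= b.
  by apply/ss_ab => // rho ops nt; exact/ltW/st1.
(* At an endpoint other than [a = 0] some inequality is an equality, which
   excludes stability. *)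
split=> [st|/andP[at_ tb] rho ops nt].
  have strict := stE t t0 st.
  have /andP[at_ tb] : a <= t <= b by apply/ss_ab => // rho ops nt; exact/ltW/st.
  rewrite !lt_neqAle at_ tb !andbT; apply/andP; split; apply/eqP => tE.
    case: alow => [aE|[p pE pa]].
      by apply: not00; rewrite -tE aE rmorph0.
    by have := strict p pE; rewrite -tE pa ltxx.
  by have [p pE pb] := bup; have := strict p pE; rewrite tE pb ltxx.
(* As a function of the parameter, [mu] for [rho] is affine, at most [0] at [a]
   and at [b], and negative at [t1]; hence it is negative inside the interval. *)
have := ssa rho ops nt; have := ssb rho ops nt; have := st1 rho ops nt.
rewrite /mu; case: (xget _ _) => g r /=; rewrite /mu_diag.
move: (_%:~R) (_%:~R) => A B; move: t1ab => /andP[at1 t1b] lt1 leb lea.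
by have [B0|B0|B0] := ltgtP B 0; nra.
Qed.
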